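(* Let $X$ be a real Banach space and let $X^*$ be its topological dual. Let $T:X\rightrightarrows X^*$ be a lower semicontinuous operator with convex domain $D(T)$. Let $D\subseteq D(T)$ be self segment-dense in $D(T)$ and assume that $T$ is locally strictly quasimonotone on $D$. Assume further that for all $x,y\in D(T)$ with $x\neq y$, all $z\in[x,y]\cap(D(T)\setminus D)$ and all $z^*\in T(z)$ one has $\langle z^*,y-x\rangle\neq0$. Then $T$ is strictly quasimonotone.
   Context: $\langle x^*,x\rangle = x^*(x)$ for $x^*\in X^*$, $x\in X$. For $x,y\in X$: $[x,y]=\{x+t(y-x):t\in[0,1]\}$, $(x,y)=\{x+t(y-x):t\in(0,1)\}$. A set-valued operator $T:X\rightrightarrows X^*$ assigns to each $x\in X$ a (possibly empty) set $T(x)\subseteq X^*$; its domain is $D(T)=\{x:T(x)\ne\emptyset\}$ and its graph is $G(T)=\{(x,x^* ):x^*\in T(x)\}$. The restriction $T|_A$ agrees with $T$ on $A$ and is empty-valued elsewhere. $T$ is lower semicontinuous if for every $x\in D(T)$ and every (norm-)open $N\subseteq X^*$ with $T(x)\cap N\ne\emptyset$ there is a neighborhood $M$ of $x$ such that $T(y)\cap N\neq\emptyset$ for all $y\in M\cap D(T)$. $P\subseteq S$ is dense in $S$ if $S\subseteq \mathrm{cl}(P)$. For $U\subseteq V\subseteq X$ with $V$ convex, $U$ is self segment-dense in $V$ if $U$ is dense in $V$ and for all $x,y\in U$ the set $[x,y]\cap U$ is dense in $[x,y]$. $T$ is quasimonotone if for all $(x,x^* ),(y,y^* )\in G(T)$: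 $\langle x^*,y-x\rangle>0\Rightarrow\langle y^*,y-x\rangle\ge0$. $T$ is strictly quasimonotone if it is quasimonotone and for all $x,y\in D(T)$, $x\ne y$, there exist $z\in(x,y)$ and $z^*\in T(z)$ with $\langle z^*,y-x\rangle\ne0$. For $D\subseteq D(T)$, $T$ is locally strictly quasimonotone on $D$ if every $x\in D$ has an open neighborhood $U_x$ such that $T|_{U_x\cap D}$ is strictly quasimonotone (so in particular the point $z$ above lies in $U_x\cap D$). *)

(* Defs.v *)
From HB Require Import structures.
From mathcomp Require Import all_boot all_order all_algebra.
From mathcomp Require Import all_classical all_reals all_analysis.

Set Implicit Arguments.
Unset Strict Implicit.
Unset Printing Implicit Defensive.

Import Order.TTheory GRing.Theory Num.Theory.
Import numFieldNormedType.Exports.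

Local Open Scope classical_set_scope.
Local Open Scope ring_scope.

Section Dual.
Context {R : realType} {X : normedModType R}.

Definition continuous_linear : {pred X -> R^o} :=
  [pred f : X -> R^o | `[< linear f /\ continuous f >]].

Lemma continuous_linear_submod_closed : submod_closed continuous_linear.
Proof.
split=> [|a f g /asboolP[lf cf] /asboolP[lg cg]]; apply/asboolP; split.
- by move=> a x y; rewrite /= -[RHS]/(a *: 0 + 0) scaler0 addr0.
- exact: cst_continuous.
- move=> b x y; rewrite /= -[LHS]/(a *: f (b *: x + y) + g (b *: x + y)).
  rewrite -[RHS]/(b *: (a *: f x + g x) + (a *: f y + g y)).
  by rewrite lf lg !scalerDr !scalerA (mulrC a) addrACA.
- move=> x; apply: cvgD; last exact: cg.
  by apply: cvgZr; exact: cf.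
Qed.

HB.instance Definition _ := GRing.isSubmodClosed.Build R (X -> R^o)
  continuous_linear continuous_linear_submod_closed.

End Dual.

Record dual (R : realType) (X : normedModType R) := Dual {
  dual_fun :> X -> R^o ;
  dual_funP : dual_fun \in continuous_linear }.

Section DualNormed.
Context {R : realType} {X : normedModType R}.
Implicit Types f g : dual X.

HB.instance Definition _ := [isSub for @dual_fun R X].
HB.instance Definition _ := [Choice of dual X by <:].
HB.instance Definition _ := [SubChoice_isSubLmodule of dual X by <:].

Lemma dual_linear f : linear f.
Proof. by have /asboolP[] := dual_funP f. Qed.

Lemma dual_continuous f : continuous f.
Proof. by have /asboolP[] := dual_funP f. Qed.

HB.instance Definition _ f := GRing.isLinear.Build _ _ _ _ f (dual_linear f).

Lemma dualP f g : f =1 g -> f = g.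
Proof. by move=> fg; apply/val_inj/funext. Qed.

Definition dual_norm f : R := sup [set `|f x| | x in [set x : X | `|x| <= 1]].

Lemma dual_norm_has_sup f :
  has_sup [set `|f x| | x in [set x : X | `|x| <= 1]].
Proof.
split; first by exists `|f 0|, 0 => //=; rewrite normr0.
have /bounded_funP/(_ 1)[M fM] : bounded_near f (nbhs (0 : X)).
  exact/linear_bounded_continuous/dual_continuous.
by exists M => _ [x /= x1 <-]; exact: fM.
Qed.

Lemma dual_norm_ub f (x : X) : `|x| <= 1 -> `|f x| <= dual_norm f.
Proof.
by move=> x1; apply: (ub_le_sup (dual_norm_has_sup f).2); exists x.
Qed.

Lemma dual_norm_le f (M : R) :
  (forall x : X, `|x| <= 1 -> `|f x| <= M) -> dual_norm f <= M.
Proof.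
move=> fM; apply: (ge_sup (dual_norm_has_sup f).1) => _ [x /= x1 <-].
exact: fM.
Qed.

Lemma dual_norm_triangle f g : dual_norm (f + g) <= dual_norm f + dual_norm g.
Proof.
apply: dual_norm_le => x x1; apply: le_trans (ler_normD _ _) _.
by rewrite lerD// dual_norm_ub.
Qed.

Lemma dual_norm_leZ (a : R) f : dual_norm (a *: f) <= `|a| * dual_norm f.
Proof.
apply: dual_norm_le => x x1; rewrite [(a *: f) x]/(a * f x) normrM.
by rewrite ler_wpM2l// dual_norm_ub.
Qed.

Lemma dual_normZ (a : R) f : dual_norm (a *: f) = `|a| * dual_norm f.
Proof.
apply/eqP; rewrite eq_le dual_norm_leZ/=.
have [->|a0] := eqVneq a 0.
  rewrite normr0 mul0r; apply: le_trans (normr_ge0 _) _; last first.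
    by apply: (dual_norm_ub (0 *: f) (x := 0)); rewrite normr0.
have := dual_norm_leZ a^-1 (a *: f).
by rewrite scalerA mulVf// scale1r normfV ler_pdivlMl ?normr_gt0.
Qed.

Lemma dual_norm0_eq0 f : dual_norm f = 0 -> f = 0.
Proof.
move=> f0; apply: dualP => x; rewrite [RHS]/(0 : R).
have [->|x0] := eqVneq x 0; first by rewrite linear0.
have nx : `|x| != 0 by rewrite normr_eq0.
have : `|f (`|x|^-1 *: x)| <= 0.
  by rewrite -f0 dual_norm_ub// normrZ normfV normr_id mulVf.
rewrite normr_le0 linearZ/= => /eqP/(congr1 ( *%R `|x|)).
by rewrite [_ *: _]/(_ * _) mulrA divff// mul1r mulr0.
Qed.

(* The topology of [dual X] is the one induced by the operator norm. *)
HB.instance Definition _ := Lmodule_isNormed.Build R (dual X)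
  dual_norm_triangle dual_normZ dual_norm0_eq0.

End DualNormed.

Section Operators.
Context {R : realType} {X : normedModType R}.
Implicit Types (T : X -> set (dual X)) (A D U V P S : set X) (x y z : X).

Definition closed_segment x y : set X :=
  [set x + t *: (y - x) | t in `[(0 : R), 1]].

Definition open_segment x y : set X :=
  [set x + t *: (y - x) | t in `](0 : R), 1[].

Definition domain T : set X := [set x | T x !=set0].

Definition restriction T A : X -> set (dual X) :=
  fun x => [set xs | A x /\ T x xs].

Definition lower_semicontinuous_op T := forall x, domain T x ->
  forall N : set (dual X), open N -> T x `&` N !=set0 ->
  exists2 M : set X, nbhs x M &
    forall y, (M `&` domain T) y -> T y `&` N !=set0.

(* Density of P in S relative to S, for P included in S; the library's [dense]
   is density in the whole space. *)
Definition dense_in P S := S `<=` closure P.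

Definition self_segment_dense U V :=
  dense_in U V /\
  forall x y, U x -> U y ->
    dense_in (closed_segment x y `&` U) (closed_segment x y).

Definition quasimonotone T :=
  forall x y (xs ys : dual X), T x xs -> T y ys ->
    0 < xs (y - x) -> 0 <= ys (y - x).

Definition strictly_quasimonotone T :=
  quasimonotone T /\
  forall x y, domain T x -> domain T y -> x != y ->
    exists z (zs : dual X),
      [/\ open_segment x y z, T z zs & zs (y - x) != 0].

Definition locally_strictly_quasimonotone T D :=
  forall x, D x -> exists2 U : set X, open_nbhs x U &
    strictly_quasimonotone (restriction T (U `&` D)).

End Operators.

(* Main.v *)
(* Suppose quasimonotonicity fails at x and y. By lower semicontinuity the two
   strict inequalities persist under small perturbations, so x and y may be
   taken in D. On the segment from x to y let A (resp. B) be the set of points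
   where some element of T is positive (resp. negative) in the direction y - x.
   Both are relatively open; every segment point outside D lies in A or B, and
   near a point of D local strict quasimonotonicity forbids a point of A followed
   by a point of B and makes A and B together dense. Density of D in the segment
   makes A and B disjoint, so the first boundary point of B is a point of D with
   points of A just before it and points of B just after it, which is absurd. *)
Require Import Defs.
From mathcomp Require Import all_boot all_order all_algebra.
From mathcomp Require Import all_classical all_reals all_analysis.
From mathcomp Require Import lra.
Import Order.TTheory GRing.Theory Num.Theory.
Import numFieldNormedType.Exports.
Local Open Scope classical_set_scope.
Local Open Scope ring_scope.

(** * Sign patterns on the unit interval *)

(** Endpoints of the unit interval are covered by taking the interval on one side of [t]: to its
    left if [t > 0], to its right if [t = 0]. Density, which speaks of open intervals, can then be
    applied inside any neighbourhood. *)
Lemma near_unit_interval {R : realType} (P : set R) (t : R) :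
  0 <= t <= 1 -> (\forall s \near t, P s) ->
  exists a b : R, [/\ 0 <= a, a < b, b <= 1 & forall s, a < s < b -> P s].
Proof.
move=> /andP[t0 t1] /nbhs_ballP[e /= e0 eP].
have eP' s : t - e < s -> s < t + e -> P s.
  by move=> h1 h2; apply: eP; rewrite /ball/= ltr_distlC h1.
have [t_gt0|t_le0] := ltrP 0 t.
- exists (Num.max 0 (t - e)), t; split => //.
  + by rewrite le_max lexx.
  + by rewrite gt_max t_gt0; lra.
  + move=> s; rewrite gt_max => /andP[/andP[_ h1] h2]; apply: eP' => //; lra.
- exists 0, (Num.min 1 e); split => //.
  + by rewrite lt_min e0 ltr01.
  + by rewrite ge_min lexx.
  + by move=> s; rewrite lt_min => /andP[h1 /andP[_ h2]]; apply: eP'; lra.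
Qed.

Lemma near_left_interval {R : realType} (P : set R) (t : R) :
  0 < t -> (\forall s \near t, P s) ->
  exists a : R, [/\ 0 <= a, a < t & forall s, a < s < t -> P s].
Proof.
move=> t0 /nbhs_ballP[e /= e0 eP].
exists (Num.max 0 (t - e)); split.
- by rewrite le_max lexx.
- by rewrite gt_max t0; lra.
- move=> s; rewrite gt_max => /andP[/andP[_ h1] h2].
  by apply: eP; rewrite /ball/= ltr_distlC h1; lra.
Qed.

(* [A] and [B] are disjoint and open in [0, 1]; [t0 := inf B] lies in neither,
   hence in [S], and the two local conditions at [t0] clash because there are
   points of [A] just before [t0] and points of [B] just after it. *)
Lemma no_sign_change {R : realType} (A B S : set R) :
  (forall t, 0 <= t <= 1 -> A t -> \forall s \near t, 0 <= s <= 1 -> A s) ->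
  (forall t, 0 <= t <= 1 -> B t -> \forall s \near t, 0 <= s <= 1 -> B s) ->
  (forall a b, 0 <= a -> a < b -> b <= 1 -> exists2 t, a < t < b & S t) ->
  (forall t, 0 <= t <= 1 -> ~ S t -> A t \/ B t) ->
  (forall t, S t -> exists2 U : set R, nbhs t U &
     (forall s s', (U `&` S) s -> (U `&` S) s' -> s < s' -> A s -> ~ B s') /\
     (forall s s', (U `&` S) s -> (U `&` S) s' -> s < s' ->
        exists z, [/\ s < z < s', (U `&` S) z & A z \/ B z])) ->
  A 0 -> ~ B 1.
Proof.
move=> oA oB dS nS locS A0 B1.
(* On an interval contained in both [A] and [B], two close enough points of [S] form a pair
   forbidden by the local condition. *)
have disj t : 0 <= t <= 1 -> A t -> ~ B t.
  move=> t01 At Bt.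
  have : \forall s \near t, 0 <= s <= 1 -> A s /\ B s.
    by apply: filterS2 (oA _ t01 At) (oB _ t01 Bt) => s + + s01; split; auto.
  move=> /(near_unit_interval _ _ t01)[a [b [a0 ab b1 abAB]]].
  have [s1 /andP[as1 s1b] Ss1] := dS _ _ a0 ab b1.
  have [U Us1 [noAB _]] := locS _ Ss1.
  have s101 : 0 <= s1 <= 1 by lra.
  have : \forall s \near s1, U s /\ a < s < b.
    near=> s; split; first by near: s.
    by apply/andP; split; near: s; [exact: lt_nbhsr|exact: lt_nbhsl].
  move=> /(near_unit_interval _ _ s101)[c [d [c0 cd d1 cdU]]].
  have [s /andP[cs sd] Ss] := dS _ _ c0 cd d1.
  have [s' /andP[ss' s'd] Ss'] := dS _ _ (ltW (le_lt_trans c0 cs)) sd d1.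
  have [Us asb] : U s /\ a < s < b by apply: cdU; lra.
  have [Us' as'b] : U s' /\ a < s' < b by apply: cdU; lra.
  apply: (noAB s s') => //.
  - by apply: (abAB s asb _).1; lra.
  - by apply: (abAB s' as'b _).2; lra.
pose B01 := [set t | 0 <= t <= 1 /\ B t].
have B01_1 : B01 1 by split => //; lra.
have B01_lb : lbound B01 0 by move=> s [/andP[]].
have B01_inf : has_inf B01 by split; [exists 1|exists 0].
set t0 := inf B01.
have t0_ge0 : 0 <= t0 by apply: lb_le_inf => //; exists 1.
have t0_le1 : t0 <= 1 by apply: ge_inf => //; exists 0.
have t001 : 0 <= t0 <= 1 by rewrite t0_ge0.
have nB s : 0 <= s -> s < t0 -> ~ B s.
  move=> s0 st0 Bs; suff : t0 <= s by lra.
  by apply: ge_inf; [exists 0|split => //; lra].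
(* Points of [B] come arbitrarily close to the infimum [t0] from the right, [t0] itself not being
   excluded. *)
have nearB (P : set R) : (\forall s \near t0, P s) ->
    exists s, [/\ t0 <= s, s <= 1, B s & P s].
  move=> /nbhs_ballP[e /= e0 eP].
  have [s [/andP[s0 s1] Bs] se] := inf_adherent e0 B01_inf.
  have t0s : t0 <= s by apply: ge_inf; [exists 0|split => //; lra].
  by exists s; split => //; apply: eP; rewrite /ball/= ltr_distlC; lra.
have nAt0 : ~ A t0.
  move=> /(oA _ t001)/nearB[s [t0s s1 Bs As]].
  have s01 : 0 <= s <= 1 by lra.
  exact: disj s01 (As s01) Bs.
have t0_gt0 : 0 < t0.
  by rewrite lt_neqAle t0_ge0 andbT; apply/eqP => t0E; apply: nAt0; rewrite -t0E.
(* Otherwise openness would put points of [B] to the left of [t0]. *)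
have nBt0 : ~ B t0.
  move=> /(oB _ t001)/(near_left_interval _ _ t0_gt0)[a [a0 at0 aB]].
  by apply: (nB ((a + t0) / 2)); [lra|lra|apply: aB; lra].
have St0 : S t0 by apply: contrapT => /(nS _ t001)[].
have [U Ut0 [noAB denseAB]] := locS _ St0.
have [a [a0 at0 aU]] := near_left_interval U _ t0_gt0 Ut0.
have [s1 /andP[as1 s1t0] Ss1] := dS _ _ a0 at0 t0_le1.
have [s2 /andP[s12 s2t0] Ss2] := dS _ _ (ltW (le_lt_trans a0 as1)) s1t0 t0_le1.
have Us1 : U s1 by apply: aU; lra.
have Us2 : U s2 by apply: aU; lra.
have [z [/andP[s1z zs2] [Uz Sz] ABz]] :=
  denseAB s1 s2 (conj Us1 Ss1) (conj Us2 Ss2) s12.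
(* There is no point of [B] to the left of [t0]. *)
have Az : A z by case: ABz => // /nB []; lra.
have [s' [t0s' s'1 Bs' [Us' zs']]] :
    exists s, [/\ t0 <= s, s <= 1, B s & (nbhs s U /\ z < s)].
  apply: nearB; near=> s; split; near: s; first exact: nbhs_interior.
  by apply: lt_nbhsr; lra.
have s'01 : 0 <= s' <= 1 by lra.
(* The point [s'] need not lie in [S]; openness of [B] and density of [S] replace it by some [w] in
   [S], still to the right of [z]. *)
have : \forall s \near s', [/\ U s, z < s & 0 <= s <= 1 -> B s].
  near=> s; split; near: s => //; [exact: lt_nbhsr|exact: oB].
move=> /(near_unit_interval _ _ s'01)[c [d [c0 cd d1 cdU]]].
have [w /andP[cw wd] Sw] := dS _ _ c0 cd d1.
have [Uw zw Bw] : [/\ U w, z < w & 0 <= w <= 1 -> B w] by apply: cdU; lra.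
by apply: (noAB z w) => //; apply: Bw; lra.
Unshelve. all: by end_near. Qed.

(** * Stability of strict inequalities *)

(** Negative values are treated as positive values in the direction [- v], so that one stability
    lemma serves both signs. *)
Definition has_positive {R : realType} {X : normedModType R}
    (T : X -> set (dual X)) (v x : X) : Prop :=
  exists2 f : dual X, T x f & 0 < f v.

Lemma norm_dual_le {R : realType} {X : normedModType R} (f : dual X) (v : X) :
  `|f v| <= `|f| * `|v|.
Proof.
have [->|v0] := eqVneq v 0; first by rewrite linear0 !normr0 mulr0.
have nv : 0 < `|v| by rewrite normr_gt0.
have : `|f (`|v|^-1 *: v)| <= `|f|.
  by apply: dual_norm_ub; rewrite normrZ normfV normr_id mulVf ?gt_eqF.
rewrite linearZ/= normrM normfV normr_id mulrC.
by rewrite ler_pdivrMr.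
Qed.

(** Write [f v = f0 v + (f - f0) v]: the first term stays above [f0 v0 / 2], and the second is
    smaller than that in absolute value. *)
Lemma near_eval_gt0 {R : realType} {X : normedModType R} (f0 : dual X) (v0 : X) :
  0 < f0 v0 -> \forall v \near v0 & f \near f0, 0 < (f : dual X) v.
Proof.
move=> f0v0; have c0 : 0 < f0 v0 / 2 by rewrite divr_gt0.
have d0 : 0 < `|v0| + 1 by rewrite ltr_wpDl.
near=> v f.
have fE : f v = f0 v + (f - f0) v by rewrite -[RHS]/(f0 v + (f v - f0 v)) subrKC.
have h1 : f0 v0 / 2 < f0 v.
  near: v; apply: (cvgr_gt (f0 v0)); first exact: dual_continuous.
  by rewrite ltr_pdivrMr// mulr_natr mulr2n ltrDl.
have h2 : `|v| < `|v0| + 1.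
  near: v; apply: (cvgr_norm_lt v0); [exact: cvg_id|by rewrite ltrDl].
(* The bound [|v0| + 1] dominates [|v|] near [v0] and is nonzero even when [v0 = 0]. *)
have h3 : `|f - f0| < f0 v0 / 2 / (`|v0| + 1).
  rewrite distrC; near: f; apply: (cvgr_dist_lt id f0).
  - exact: cvg_id.
  - by rewrite divr_gt0.
have h4 : `|(f - f0) v| < f0 v0 / 2.
  apply: le_lt_trans (norm_dual_le _ _) _.
  have -> : f0 v0 / 2 = f0 v0 / 2 / (`|v0| + 1) * (`|v0| + 1).
    by rewrite divfK// gt_eqF.
  by apply: ltr_pM.
move: h4; rewrite ltr_norml fE => /andP[h4 _]; lra.
Unshelve. all: by end_near. Qed.

(** The direction varies together with the base point, because moving the endpoints of a segment
    also changes their difference. *)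
Lemma near_has_positive {R : realType} {X : normedModType R}
    (T : X -> set (dual X)) (v x : X) :
  lower_semicontinuous_op T -> has_positive T v x ->
  \forall v' \near v & x' \near x, domain T x' -> has_positive T v' x'.
Proof.
move=> lscT [f Txf fv].
have [[V F] /= [Vv Ff] VF] := near_eval_gt0 f v fv.
have Txx : domain T x by exists f.
(* Lower semicontinuity is stated for open sets, while [F] is only a neighbourhood of [f]; hence its
   interior. *)
have [M Mx MF] := lscT x Txx F^° (open_interior F) (ex_intro _ f (conj Txf Ff)).
exists (V, M) => // -[v' x']/= [Vv' Mx'] Tx'.
have [g [Tx'g Fg]] := MF x' (conj Mx' Tx').
exists g => //; apply: (VF (v', g)); split => //=; exact: interior_subset Fg.
Qed.

(** * Restriction to lines and segments *)

Lemma cvg_line {R : realType} {X : normedModType R} (x e : X) (t : R) :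
  x + s *: e @[s --> t] --> x + t *: e.
Proof. by apply: cvgD; [exact: cvg_cst|apply: cvgZ; [exact: cvg_id|exact: cvg_cst]]. Qed.

Lemma line_sub {R : realType} {X : normedModType R} (x e : X) (s t : R) :
  (x + t *: e) - (x + s *: e) = (t - s) *: e.
Proof. by rewrite opprD addrACA subrr add0r scalerBl. Qed.

Lemma open_segment_line {R : realType} {X : normedModType R} (x e z : X) (s t : R) :
  s < t -> open_segment (x + s *: e) (x + t *: e) z ->
  exists2 r, s < r < t & z = x + r *: e.
Proof.
move=> st [r]; rewrite /= in_itv/= => /andP[r0 r1] <-.
exists (s + r * (t - s)).
  apply/andP; split; first by rewrite ltrDl mulr_gt0// subr_gt0.
  have : r * (t - s) < t - s by rewrite gtr_pMl// subr_gt0.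
  lra.
by rewrite line_sub scalerA -addrA -scalerDl.
Qed.

Lemma convex_line {R : realType} {X : normedModType R} (V : set X) (x y : X) (t : R) :
  convex_set (V : set (convex_lmodType X)) -> V x -> V y ->
  0 <= t <= 1 -> V (x + t *: (y - x)).
Proof.
move=> cV Vx Vy /andP[t0 t1].
(* The weight [t] goes to the first argument of [conv], so [y] comes first. *)
have := cV y x (Itv01 t0 t1); rewrite !inE => /(_ Vy Vx).
rewrite /conv/= => Vt; suff <- : t *: y + unstable.onem t *: x = x + t *: (y - x) by [].
by rewrite /unstable.onem scalerBl scale1r scalerBr addrCA.
Qed.

(** Approximate the point with parameter [(a + b) / 2] to within [(b - a) / 2 * |y - x|]: in terms
    of parameters this is exactly the half-length of the interval. *)
Lemma self_segment_dense_line {R : realType} {X : normedModType R}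
    (D V : set X) (x y : X) (a b : R) :
  self_segment_dense D V -> D x -> D y -> x != y ->
  0 <= a -> a < b -> b <= 1 ->
  exists2 t, a < t < b & (0 <= t <= 1) /\ D (x + t *: (y - x)).
Proof.
move=> [_ sD] Dx Dy xy a0 ab b1.
have e0 : 0 < `|y - x| by rewrite normr_gt0 subr_eq0 eq_sym.
have m01 : 0 <= (a + b) / 2 <= 1 by lra.
have [] := sD x y Dx Dy (x + (a + b) / 2 *: (y - x)) _
  (ball (x + (a + b) / 2 *: (y - x)) ((b - a) / 2 * `|y - x|)).
- by exists ((a + b) / 2) => //=; rewrite in_itv.
- by apply: nbhsx_ballx; rewrite mulr_gt0//; lra.
move=> p [[[t /=]]]; rewrite in_itv/= => t01 <- Dt.
rewrite -ball_normE/= line_sub normrZ ltr_pM2r// ltr_distlC => /andP[h1 h2].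
by exists t => //; lra.
Qed.

Lemma quasimonotone_line {R : realType} {X : normedModType R}
    (T : X -> set (dual X)) (x e : X) (s t : R) :
  quasimonotone T -> s < t ->
  has_positive T e (x + s *: e) -> ~ has_positive T (- e) (x + t *: e).
Proof.
move=> qT st [f Tf fe] [g Tg ge].
have ts : 0 < t - s by rewrite subr_gt0.
have := qT _ _ f g Tf Tg; rewrite !line_sub !linearZ/=.
rewrite pmulr_rgt0// pmulr_rge0// => /(_ fe).
by move: ge; rewrite linearN/= oppr_gt0 leNgt => ->.
Qed.

Lemma has_positive_restriction {R : realType} {X : normedModType R}
    (T : X -> set (dual X)) (A : set X) (v x : X) :
  A x -> has_positive T v x -> has_positive (restriction T A) v x.
Proof. by move=> Ax [f Tf fv]; exists f. Qed.

Lemma strictly_quasimonotone_line {R : realType} {X : normedModType R}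
    (T : X -> set (dual X)) (A : set X) (x e : X) (s t : R) :
  strictly_quasimonotone (restriction T A) -> A `<=` domain T -> e != 0 ->
  s < t -> A (x + s *: e) -> A (x + t *: e) ->
  exists r (f : dual X),
    [/\ s < r < t, A (x + r *: e), T (x + r *: e) f & f e != 0].
Proof.
move=> [_ sT] AT e0 st As At.
have dom p : A p -> domain (restriction T A) p.
  by move=> Ap; have [f Tf] := AT p Ap; exists f.
have st0 : x + s *: e != x + t *: e.
  by rewrite eq_sym -subr_eq0 line_sub scaler_eq0 (negbTE e0) orbF subr_eq0 gt_eqF.
have [z [f [/(open_segment_line _ _ _ _ _ st)[r rst ->] [Ar Tf]]]] :=
  sT _ _ (dom _ As) (dom _ At) st0.
rewrite line_sub linearZ/= mulf_eq0 negb_or => /andP[_ fe].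
by exists r, f.
Qed.

Lemma near_line {R : realType} {X : normedModType R} (x e : X) (t : R) (U : set X) :
  nbhs (x + t *: e) U -> \forall s \near t, U (x + s *: e).
Proof. by move=> Ut; exact: (cvg_line x e t U Ut). Qed.

Lemma near_has_positive_line {R : realType} {X : normedModType R}
    (T : X -> set (dual X)) (v x e : X) (t : R) :
  lower_semicontinuous_op T -> has_positive T v (x + t *: e) ->
  \forall s \near t, domain T (x + s *: e) -> has_positive T v (x + s *: e).
Proof.
move=> lscT Tt.
apply: (near_line x e t [set p | domain T p -> has_positive T v p]).
have [[V W] /= [Vv Wt] VW] := near_has_positive T v _ lscT Tt.
apply: filterS Wt => w Ww Tw.
by apply: (VW (v, w) _ Tw); split => //=; exact: nbhs_singleton Vv.
Qed.

(** * From segments to the whole domain *)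

(** Pulling [T] and [D] back along the segment reduces this to [no_sign_change]: lower
    semicontinuity gives openness, and nonvanishing off [D] forces a sign there. *)
Lemma no_sign_change_segment {R : realType} {X : normedModType R}
    (T : X -> set (dual X)) (D : set X) (x y : X) :
  lower_semicontinuous_op T ->
  convex_set (domain T : set (convex_lmodType X)) ->
  D `<=` domain T ->
  self_segment_dense D (domain T) ->
  locally_strictly_quasimonotone T D ->
  (forall x y : X, domain T x -> domain T y -> x != y ->
     forall z : X, (closed_segment x y `&` (domain T `\` D)) z ->
     forall zs : dual X, T z zs -> zs (y - x) != 0) ->
  D x -> D y ->
  has_positive T (y - x) x -> ~ has_positive T (x - y) y.
Proof.
move=> lscT cT DT sD lT nT Dx Dy Tx Ty.
have xy : x != y.
  by apply/eqP => xy; case: Tx => f _; rewrite xy subrr linear0 ltxx.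
have e0 : y - x != 0 by rewrite subr_eq0 eq_sym.
have domT t : 0 <= t <= 1 -> domain T (x + t *: (y - x)).
  by apply: convex_line => //; exact: DT.
have signed z (f : dual X) : T z f -> f (y - x) != 0 ->
    has_positive T (y - x) z \/ has_positive T (- (y - x)) z.
  move=> Tf; rewrite neq_lt => /orP[f0|f0]; [right|left]; exists f => //.
  by rewrite linearN/= oppr_gt0.
apply: (@no_sign_change R
  [set t | has_positive T (y - x) (x + t *: (y - x))]
  [set t | has_positive T (- (y - x)) (x + t *: (y - x))]
  [set t | 0 <= t <= 1 /\ D (x + t *: (y - x))]).
- move=> t _ /(near_has_positive_line _ _ _ _ _ lscT).
  by apply: filterS => s h /domT; exact: h.
- move=> t _ /(near_has_positive_line _ _ _ _ _ lscT).
  by apply: filterS => s h /domT; exact: h.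
- by move=> a b; exact: (self_segment_dense_line D (domain T)).
- move=> t t01 nD; have [f Tf] := domT t t01; apply: (signed _ f) => //.
  apply: (nT x y _ _ xy (x + t *: (y - x))) => //; [exact: DT|exact: DT|].
  split; first by exists t => //=; rewrite in_itv.
  by split; [exact: domT|move=> Dt; exact: nD].
- move=> t [t01 Dt]; have [U /open_nbhs_nbhs Ut sU] := lT _ Dt.
  exists [set s | U (x + s *: (y - x))]; first exact: near_line.
  split=> s s' [/= Us [s01 Ds]] [/= Us' [s'01 Ds']] ss'.
    move=> /(has_positive_restriction _ (U `&` D) _ _ (conj Us Ds)) As.
    move=> /(has_positive_restriction _ (U `&` D) _ _ (conj Us' Ds')).
    exact: quasimonotone_line sU.1 ss' As.
  have [r [f [rss' [Ur Dr] Tf fe]]] :=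
    strictly_quasimonotone_line T (U `&` D) x _ _ _ sU
      (fun p Ap => DT p Ap.2) e0 ss' (conj Us Ds) (conj Us' Ds').
  exists r; split => //; first by do 2 split => //; lra.
  exact: signed Tf fe.
- by rewrite /= scale0r addr0.
- by rewrite /= scale1r subrKC opprB.
Qed.

Theorem theorem3p2 (R : realType) (X : completeNormedModType R)
    (T : X -> set (dual X)) (D : set X) :
  lower_semicontinuous_op T ->
  convex_set (domain T : set (convex_lmodType X)) ->
  D `<=` domain T ->
  self_segment_dense D (domain T) ->
  locally_strictly_quasimonotone T D ->
  (forall x y : X, domain T x -> domain T y -> x != y ->
     forall z : X, (closed_segment x y `&` (domain T `\` D)) z ->
     forall zs : dual X, T z zs -> zs (y - x) != 0) ->
  strictly_quasimonotone T.
Proof.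
move=> lscT cT DT sD lT nT; split.
  move=> x y f g Tf Tg fxy; rewrite leNgt; apply/negP => gxy.
  have Tx : has_positive T (y - x) x by exists f.
  have Ty : has_positive T (x - y) y.
    by exists g => //; rewrite -opprB linearN/= oppr_gt0.
  have [[V W] /= [Vx Wx] VWx] := near_has_positive T _ _ lscT Tx.
  have [[V' W'] /= [Vy Wy] VWy] := near_has_positive T _ _ lscT Ty.
  (* Continuity of subtraction lets [x'] and [y'] be chosen so close to [x] and [y] that both new
     directions remain admissible. *)
  have cB (p q : X) : z.1 - z.2 @[z --> (p, q)] --> p - q.
    by apply: cvgB; [exact: cvg_fst|exact: cvg_snd].
  have [[A B] /= [Ay Bx] AB] := cB y x V Vx.
  have [[A' B'] /= [Ax By] AB'] := cB x y V' Vy.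
  have [x' [Dx' [[Wx' Bx'] Ax']]] := sD.1 x (ex_intro _ f Tf) _
    (filterI (filterI Wx Bx) Ax).
  have [y' [Dy' [[Wy' Ay'] By']]] := sD.1 y (ex_intro _ g Tg) _
    (filterI (filterI Wy Ay) By).
  apply: (no_sign_change_segment T D x' y') => //.
  - by apply: (VWx (y' - x', x') _ (DT _ Dx')); split => //; exact: (AB (y', x')).
  - by apply: (VWy (x' - y', y') _ (DT _ Dy')); split => //; exact: (AB' (x', y')).
move=> x y Tx Ty xy.
(* A point of the open segment outside [D] serves directly by the nonvanishing hypothesis; otherwise
   the open segment lies in [D], and local strictness at its midpoint suffices. *)
have [[z [xyz nDz]]|allD] := pselect (exists z, open_segment x y z /\ ~ D z).
  move: xyz nDz => [t]; rewrite /= in_itv/= => /andP[t0 t1] <- nDz.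
  have t01 : 0 <= t <= 1 by lra.
  have Tz := convex_line (domain T) x y t cT Tx Ty t01.
  have [f Tf] := Tz; exists (x + t *: (y - x)), f; split => //.
    by exists t => //=; rewrite in_itv/= t0 t1.
  apply: (nT x y Tx Ty xy) Tf; split => //.
  by exists t => //=; rewrite in_itv.
have segD t : 0 < t < 1 -> D (x + t *: (y - x)).
  move=> t01; apply: contrapT => nDt; apply: allD; exists (x + t *: (y - x)).
  by split => //; exists t => //=; rewrite in_itv.
have [U /open_nbhs_nbhs Um sU] := lT _ (segD (1 / 2) ltac:(lra)).
have [a [b [a0 ab b1 abU]]] :=
  near_unit_interval _ _ (ltac:(lra) : 0 <= 1 / 2 <= 1) (near_line _ _ _ _ Um).
have e0 : y - x != 0 by rewrite subr_eq0 eq_sym.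
have UD t : a < t < b -> (U `&` D) (x + t *: (y - x)).
  by move=> tab; split; [exact: abU|apply: segD; lra].
(* The trisection points of the interval from [a] to [b] are two distinct interior points to which
   local strictness applies. *)
have lt_cd : (2 * a + b) / 3 < (a + 2 * b) / 3 by lra.
have Uc : (U `&` D) (x + (2 * a + b) / 3 *: (y - x)) by apply: UD; lra.
have Ud : (U `&` D) (x + (a + 2 * b) / 3 *: (y - x)) by apply: UD; lra.
have [r [f [rcd _ Tf fe]]] := strictly_quasimonotone_line T (U `&` D) _ _ _ _
  sU (fun p Ap => DT p Ap.2) e0 lt_cd Uc Ud.
exists (x + r *: (y - x)), f; split => //.
by exists r => //=; rewrite in_itv/=; lra.
Qed.
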